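(* Let $G$ be a group, $R$ a commutative $G$-graded ring with nonzero unity, $M$ a nonzero $G$-graded $R$-module, and $K$ a graded prime $R$-submodule of $M$. Then $K$ is a graded $r$-submodule of $M$ if and only if $h(R)\cap (K:_R M)\subseteq Z(M)$.
   Context: A commutative ring $R$ is $G$-graded if $R=\bigoplus_{g\in G}R_g$ with additive subgroups $R_g$ satisfying $R_gR_h\subseteq R_{gh}$; an $R$-module $M$ is $G$-graded if $M=\bigoplus_{g\in G}M_g$ with additive subgroups $M_g$ satisfying $R_gM_h\subseteq M_{gh}$. Put $h(R)=\bigcup_{g\in G}R_g$ and $h(M)=\bigcup_{g\in G}M_g$. An $R$-submodule $K$ of $M$ is graded if $K=\bigoplus_{g\in G}(K\cap M_g)$. Notation: $(K:_R M)=\{r\in R: rM\subseteq K\}$; $Ann_M(a)=\{m\in M: am=0\}$ for $a\in R$; $Z(M)=\{a\in h(R): Ann_M(a)\neq\{0\}\}$. A proper graded $R$-submodule $K$ of $M$ is graded prime if whenever $a\in h(R)$, $x\in h(M)$ and $ax\in K$, then $x\in K$ or $a\in (K:_R M)$. A proper graded $R$-submodule $K$ of $M$ is a graded $r$-submodule if whenever $a\in h(R)$ and $x\in h(M)$ satisfy $ax\in K$ and $Ann_M(a)=\{0\}$, then $x\in K$. *)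

(* Defs.v *)
From HB Require Import structures.
From mathcomp Require Import all_boot all_order all_algebra.
From mathcomp Require Import all_classical.

Set Implicit Arguments.
Unset Strict Implicit.
Unset Printing Implicit Defensive.

Import GRing.Theory.
Local Open Scope classical_set_scope.
Local Open Scope ring_scope.

Section DirectSum.
Variables (G : groupType) (V : zmodType).
Implicit Types (W : G -> set V) (K : set V) (x : V) (f : G -> V).

(* The sum over the possibly infinite G is taken over the support of f, which
   is finite; without the finiteness clause it would default to 0. *)
Definition decomposes W x f : Prop :=
  [/\ forall g, W g (f g),
      finite_set [set g | f g != 0] &
      x = \sum_(g \in [set: G]) f g].

Definition internal_direct_sum K W : Prop :=
  [/\ forall g, zmod_closed (mem (W g)),
      forall x, K x <-> exists f, decomposes W x f &
      forall x f f', decomposes W x f -> decomposes W x f' -> f =1 f'].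

Definition homogeneous W : set V := [set x | exists g, W g x].

End DirectSum.

Definition graded_ring (G : groupType) (R : comNzRingType)
    (Rg : G -> set R) : Prop :=
  internal_direct_sum [set: R] Rg /\
  forall g h a b, Rg g a -> Rg h b -> Rg (g * h)%g (a * b).

Section GradedModule.
Variables (G : groupType) (R : comNzRingType) (M : lmodType R).
Implicit Types (Rg : G -> set R) (Mg : G -> set M) (K : set M).

Definition graded_module Rg Mg : Prop :=
  internal_direct_sum [set: M] Mg /\
  forall g h a m, Rg g a -> Mg h m -> Mg (g * h)%g (a *: m).

Definition graded_submodule Mg K : Prop :=
  submod_closed (mem K) /\ internal_direct_sum K (fun g => K `&` Mg g).

(* (K :_R M) *)
Definition residual K : set R := [set r | forall m : M, K (r *: m)].

Definition annihilator (a : R) : set M := [set m | a *: m = 0].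

(* Z(M): by convention it consists of homogeneous elements only. *)
Definition zero_divisors Rg : set R :=
  [set a | homogeneous Rg a /\ annihilator a <> [set 0]].

Definition graded_prime Rg Mg K : Prop :=
  [/\ graded_submodule Mg K, K <> [set: M] &
      forall a x, homogeneous Rg a -> homogeneous Mg x ->
        K (a *: x) -> K x \/ residual K a].

Definition graded_r_submodule Rg Mg K : Prop :=
  [/\ graded_submodule Mg K, K <> [set: M] &
      forall a x, homogeneous Rg a -> homogeneous Mg x ->
        K (a *: x) -> annihilator a = [set 0] -> K x].

End GradedModule.

Arguments zero_divisors {G R} M Rg.

(* Main.v *)
Require Import Defs.
From HB Require Import structures.
From mathcomp Require Import all_boot all_order all_algebra.
From mathcomp Require Import all_classical.

Import GRing.Theory.
Local Open Scope classical_set_scope.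
Local Open Scope ring_scope.

(** A graded prime submodule [K] can only fail to be a graded r-submodule
    because of a homogeneous [a] with [aM] inside [K]: primeness gives [x] in
    [K] from [ax] in [K] for every other homogeneous [a].  So if all the
    homogeneous elements of the residual are zero divisors on [M], the
    r-condition holds.  Conversely, suppose that [K] is a graded r-submodule
    and that [a] is homogeneous with [aM] inside [K] and with zero annihilator.
    The r-condition then puts every homogeneous element of [M] in [K], and since
    these generate [M] ([submodule_of_homogeneous]), [K] would not be proper. *)

(** Every element of a graded module is a finite sum of homogeneous ones. *)
Lemma submodule_of_homogeneous (G : groupType) (R : comNzRingType)
    (M : lmodType R) (Mg : G -> set M) (K : set M) :
  internal_direct_sum [set: M] Mg -> submod_closed (mem K) ->
  homogeneous Mg `<=` K -> K = [set: M].
Proof.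
move=> [_ decM _] [K0 Klin] hK; rewrite -subTset => x Mx.
have [f [Mf _ ->]] := (decM x).1 Mx.
apply: big_rec => [|g y _ Ky]; first exact: set_mem.
rewrite -[f g]scale1r; apply/set_mem/Klin; last exact: mem_set.
by apply/mem_set/hK; exists g.
Qed.

Theorem theorem3p8 (G : groupType) (R : comNzRingType) (M : lmodType R)
    (Rg : G -> set R) (Mg : G -> set M) (K : set M)
    (gradedR : graded_ring Rg) (gradedM : graded_module Rg Mg)
    (M_nonzero : exists m : M, m != 0)
    (primeK : graded_prime Rg Mg K) :
  graded_r_submodule Rg Mg K <->
  homogeneous Rg `&` residual K `<=` zero_divisors M Rg.
Proof.
have [gradedK properK prime] := primeK; split.
  move=> [_ _ rK] a [ha aMK]; split=> // ann0; apply: properK.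
  apply: (submodule_of_homogeneous _ _ _ _ _ gradedM.1 gradedK.1) => x hx.
  exact: (rK a).
move=> resZ; split=> // a x ha hx Kax ann0.
have [//|aMK] := prime a x ha hx Kax.
by have [_ /(_ ann0)] := resZ a (conj ha aMK).
Qed.
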